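(* Let $\gamma \geq 0$ be an integer and let $\mathcal{P}$ be a $\gamma$-pluriassociative algebra admitting a $b$-wire-unit $e$ for some $b \in [\gamma]$. Then: (i) for all $a \in [b]$, the operations $\dashv_a$, $\dashv_b$, $\vdash_a$, and $\vdash_b$ of $\mathcal{P}$ are equal; (ii) $e$ is also an $a$-wire-unit for all $a \in [b]$; (iii) $e$ is the only wire-unit of $\mathcal{P}$; (iv) if $e'$ is an $a$-bar-unit for some $a \in [b]$, then $e' = e$.
   Context: The ground field has characteristic zero; $[n] = \{1, \dots, n\}$. A $\gamma$-pluriassociative algebra is a vector space with binary linear operations $\dashv_a, \vdash_a$, $a \in [\gamma]$, satisfying for all elements $x, y, z$ and all $a, a' \in [\gamma]$ (with $a \uparrow a' := \max(a, a')$): $(x \vdash_{a'} y) \dashv_a z = x \vdash_{a'} (y \dashv_a z)$; $(x \dashv_{a \uparrow a'} y) \dashv_a z = x \dashv_a (y \vdash_{a'} z)$; $(x \dashv_{a'} y) \vdash_a z = x \vdash_a (y \vdash_{a \uparrow a'} z)$; $(x \dashv_a y) \dashv_{a \uparrow a'} z = x \dashv_a (y \dashv_{a'} z)$; $(x \vdash_{a'} y) \vdash_a z = x \vdash_{a \uparrow a'} (y \vdash_a z)$. For $a \in [\gamma]$, an element $e$ of $\mathcal{P}$ is an $a$-wire-unit if $e \dashv_a x = x = x \vdash_a e$ for all $x \in \mathcal{P}$; it is a wire-unit if it is an $a$-wire-unit for some $a \in [\gamma]$. An element $e$ is an $a$-bar-unit if $x \dashv_a e = x = e \vdash_a x$ for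 all $x \in \mathcal{P}$. *)

(* Defs.v *)
From HB Require Import structures.
From mathcomp Require Import all_boot all_order all_algebra.

Set Implicit Arguments.
Unset Strict Implicit.
Unset Printing Implicit Defensive.

Import GRing.Theory.
Local Open Scope ring_scope.

(* The index set [gamma] = {1, ..., gamma} is 'I_gamma, with i : 'I_gamma      *)
(* standing for i + 1: only the order and the maximum of indices are used, and *)
(* the shift preserves both. Thus a \in [b] is (a <= b)%O.                     *)
HB.mixin Record Lmodule_isPluriassociative (gamma : nat) (K : fieldType) P
    of GRing.Lmodule K P := {
  dashv : 'I_gamma -> {bilinear P -> P -> P};
  vdash : 'I_gamma -> {bilinear P -> P -> P};
  vdash_dashvA : forall (a a' : 'I_gamma) (x y z : P),
    dashv a (vdash a' x y) z = vdash a' x (dashv a y z);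
  dashv_vdashA : forall (a a' : 'I_gamma) (x y z : P),
    dashv a (dashv (Order.max a a') x y) z = dashv a x (vdash a' y z);
  vdash_absorbA : forall (a a' : 'I_gamma) (x y z : P),
    vdash a (dashv a' x y) z = vdash a x (vdash (Order.max a a') y z);
  dashvA : forall (a a' : 'I_gamma) (x y z : P),
    dashv (Order.max a a') (dashv a x y) z = dashv a x (dashv a' y z);
  vdashA : forall (a a' : 'I_gamma) (x y z : P),
    vdash a (vdash a' x y) z = vdash (Order.max a a') x (vdash a y z)
}.

#[short(type="pluriassocType")]
HB.structure Definition Pluriassociative (gamma : nat) (K : fieldType) :=
  { P of GRing.Lmodule K P & Lmodule_isPluriassociative gamma K P }.

Notation "x ⊣[ a ] y" := (dashv a x y)
  (at level 40, left associativity, format "x  ⊣[ a ]  y") : ring_scope.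
Notation "x ⊢[ a ] y" := (vdash a x y)
  (at level 40, left associativity, format "x  ⊢[ a ]  y") : ring_scope.

Definition is_wire_unit_at (gamma : nat) (K : fieldType)
    (P : pluriassocType gamma K) (a : 'I_gamma) (e : P) : Prop :=
  forall x : P, e ⊣[a] x = x /\ x ⊢[a] e = x.

Definition is_wire_unit (gamma : nat) (K : fieldType)
    (P : pluriassocType gamma K) (e : P) : Prop :=
  exists a : 'I_gamma, is_wire_unit_at a e.

Definition is_bar_unit_at (gamma : nat) (K : fieldType)
    (P : pluriassocType gamma K) (a : 'I_gamma) (e : P) : Prop :=
  forall x : P, x ⊣[a] e = x /\ e ⊢[a] x = x.

(* Main.v *)
(* Bracketing with e absorbs the indices up to b: evaluating
   (e ⊣_b y) ⊣_b z = e ⊣_b (y ⊢_a z) and (x ⊣_a y) ⊢_b e = x ⊢_b (y ⊢_b e)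
   for a <= b, where b is the maximum of a and b, gives ⊣_b = ⊢_a and
   ⊣_a = ⊢_b. Once the operations coincide, any two units are compared by
   multiplying them together. *)
Require Import Defs.
From HB Require Import structures.
From mathcomp Require Import all_boot all_order all_algebra.

Set Implicit Arguments.
Unset Strict Implicit.
Unset Printing Implicit Defensive.

Import Order.TTheory GRing.Theory.
Local Open Scope ring_scope.

Section WireUnit.

Variables (K : fieldType) (gamma : nat) (P : pluriassocType gamma K).
Implicit Types (a b : 'I_gamma) (e x y : P).

Lemma wire_unit_dashv_vdash b e a x y :
  is_wire_unit_at b e -> (a <= b)%O -> x ⊣[b] y = x ⊢[a] y.
Proof.
move=> eb le_ab; have := dashv_vdashA b a e x y.
by rewrite (max_idPl le_ab) !(eb _).1.
Qed.

Lemma wire_unit_vdash_dashv b e a x y :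
  is_wire_unit_at b e -> (a <= b)%O -> x ⊣[a] y = x ⊢[b] y.
Proof.
move=> eb le_ab; have := vdash_absorbA b a x y e.
by rewrite (max_idPl le_ab) !(eb _).2.
Qed.

(** Both sides equal [x ⊢[b] y]: taking [a = b] in the first comparison identifies [⊣[b]] with
    [⊢[b]]. *)
Lemma wire_unit_dashv b e a x y :
  is_wire_unit_at b e -> (a <= b)%O -> x ⊣[a] y = x ⊣[b] y.
Proof.
move=> eb le_ab; rewrite (wire_unit_vdash_dashv x y eb le_ab).
by rewrite (wire_unit_dashv_vdash x y eb (lexx b)).
Qed.

Lemma wire_unit_vdash b e a x y :
  is_wire_unit_at b e -> (a <= b)%O -> x ⊢[a] y = x ⊢[b] y.
Proof.
move=> eb le_ab; rewrite -(wire_unit_dashv_vdash x y eb le_ab).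
by rewrite (wire_unit_dashv_vdash x y eb (lexx b)).
Qed.

Lemma wire_unit_le b e a :
  is_wire_unit_at b e -> (a <= b)%O -> is_wire_unit_at a e.
Proof.
move=> eb le_ab x.
by rewrite (wire_unit_dashv _ _ eb le_ab) (wire_unit_vdash _ _ eb le_ab).
Qed.

(** Wire-units pass down to smaller indices, so at the smaller of [a] and [b] both elements are
    wire-units and can be compared. *)
Lemma wire_unit_at_inj a b e e' :
  is_wire_unit_at a e -> is_wire_unit_at b e' -> e = e'.
Proof.
wlog le_ab : a b e e' / (a <= b)%O => [th_sym ea e'b|ea e'b].
  case/orP: (le_total a b) => [le_ab|le_ba].
    exact: th_sym le_ab ea e'b.
  by symmetry; exact: th_sym le_ba e'b ea.
have e'a := wire_unit_le e'b le_ab.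
(* Here [e = e ⊢[a] e'] and [e' = e ⊣[a] e']; the two products agree because an [a]-wire-unit forces
   [⊣[a]] and [⊢[a]] to coincide. *)
rewrite -[LHS](e'a e).2 -[RHS](ea e').1; symmetry.
exact: wire_unit_dashv_vdash ea (lexx a).
Qed.

(** The product [e ⊣[b] e' = e ⊣[a] e'] is [e'] by the wire-unit law and [e] by the bar-unit law. *)
Lemma bar_unit_wire_unit a b e e' :
  is_wire_unit_at b e -> (a <= b)%O -> is_bar_unit_at a e' -> e' = e.
Proof.
move=> eb le_ab e'a.
by rewrite -[LHS](eb e').1 -(wire_unit_dashv _ _ eb le_ab) (e'a e).1.
Qed.

End WireUnit.

Theorem proposition3p2p1 (K : fieldType) (charK : [pchar K] =i pred0)
    (gamma : nat) (P : pluriassocType gamma K) (b : 'I_gamma) (e : P)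
    (eb : is_wire_unit_at b e) :
  [/\ forall a : 'I_gamma, (a <= b)%O ->
        [/\ @dashv gamma K P a =2 dashv b,
            @dashv gamma K P b =2 vdash a
          & @vdash gamma K P a =2 vdash b],
      forall a : 'I_gamma, (a <= b)%O -> is_wire_unit_at a e,
      is_wire_unit e /\ (forall e' : P, is_wire_unit e' -> e' = e)
    & forall (e' : P) (a : 'I_gamma), (a <= b)%O ->
        is_bar_unit_at a e' -> e' = e].
Proof.
split.
- move=> a le_ab; split=> x y.
  + exact: wire_unit_dashv eb le_ab.
  + exact: wire_unit_dashv_vdash eb le_ab.
  + exact: wire_unit_vdash eb le_ab.
- by move=> a; exact: wire_unit_le.
- split; first by exists b.
  (* The index [a] of [e'] may exceed [b], so uniqueness has to hold across arbitrary indices. *)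
  by move=> e' [a e'a]; exact: wire_unit_at_inj e'a eb.
- by move=> e' a; exact: bar_unit_wire_unit.
Qed.
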